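(* (1) Let $W$ be an ordered (specification) monad, $M$ a (computational) monad, and $\theta : M \to W$ an effect observation, i.e. a monad morphism. For a type $A$ and $w : W A$ put $$(\mathfrak{pre}\,\theta)\,A\,w \;=\; (m : M A) \times \big(\theta_A(m) \le_A w\big).$$ Then $\mathfrak{pre}\,\theta$ is a Dijkstra monad over $W$. It has a weakening structure given by $$\mathrm{weaken}\langle w_1 \le w_2, \langle m, \theta(m)\le w_1\rangle\rangle = \langle m, \theta(m)\le w_1\le w_2\rangle.$$ The same construction, with $m\,\mathcal R_A\,w$ in place of $\theta_A(m)\le_A w$, applies to any upward closed monadic relation $\mathcal R : M \leftrightarrow W$, and gives a functor $\mathfrak{pre} : \mathrm{MonRel}^{\le} \to \mathrm{DMon}^{\le}$. (2) The functor $\mathfrak{pre} : \mathrm{MonRel}^{\le} \to \mathrm{DMon}^{\le}$ has a left adjoint $\int$. On a Dijkstra monad $\mathcal D$ over $W$ with weakening it is given by $$\textstyle\int \mathcal D\, A \;=\; \big((w : W A) \times \mathcal D\,A\,w\big)/\!\sim,$$ where $\sim$ is generated by $\langle w, c\rangle \sim \langle w', \mathrm{weaken}\langle w \le w', c\rangle\rangle$. (3) For every effect observation $\theta : M \to W$, $\int(\mathfrak{pre}\,\theta)$ is equivalent to $\theta$.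
   Context: The setting is an extensional dependent type theory with dependent products, strong sums, identity types, a type $\mathbb P$ of proof-irrelevant propositions, and quotients by equivalence relations. A monad $M$ is a type constructor with $\mathrm{ret}^M : A \to M A$ and $\mathrm{bind}^M : M A \to (A \to M B) \to M B$ satisfying the usual monad laws. A monad morphism $\theta : M \to W$ is a family of maps $\theta_A : M A \to W A$, natural in $A$, with $\theta(\mathrm{ret}^M v) = \mathrm{ret}^W v$ and $\theta(\mathrm{bind}^M m\, f) = \mathrm{bind}^W (\theta\, m)\,(\theta\circ f)$. An ordered monad $W$ is a monad with a preorder $\le_A$ on $W A$ for each type $A$, such that bind is monotonic in both arguments: if $w_1 \le_A w_1'$ and $w_2\,x \le_B w_2'\,x$ for all $x:A$, then $\mathrm{bind}^W w_1 w_2 \le_B \mathrm{bind}^W w_1' w_2'$. A Dijkstra monad over $W$ consists of a type $\mathcal D\,A\,w$ for each type $A$ and $w : W A$, together with $\mathrm{ret}^{\mathcal D} : (x:A) \to \mathcal D\,A\,(\mathrm{ret}^W x)$ and $\mathrm{bind}^{\mathcal D} : \mathcal D\,A\,w_1 \to ((x:A)\to \mathcal D\,B\,(w_2\,x)) \to \mathcal D\,B\,(\mathrm{bind}^W w_1\,w_2)$, such that $\mathrm{bind}^{\mathcal D}\,m\,\mathrm{ret}^{\mathcal D} = m$, $\mathrm{bind}^{\mathcal D}(\mathrm{ret}^{\mathcal D}x)\, f = f\,x$ and $\mathrm{bind}^{\mathcal D}(\mathrm{bind}^{\mathcal D} m\, f)\, g = \mathrm{bind}^{\mathcal D} m\,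 (\lambda x.\,\mathrm{bind}^{\mathcal D}(f x)\, g)$; these equations are well typed thanks to the monad laws of $W$. For $\mathfrak{pre}\,\theta$ and $\mathfrak{pre}\,\mathcal R$ the return and bind are those of $M$ on the underlying elements. A weakening structure on $\mathcal D$ is a family of maps $\mathrm{weaken} : (w_1 \le_A w_2) \times \mathcal D\,A\,w_1 \to \mathcal D\,A\,w_2$ such that $\mathrm{weaken}\langle w\le w, m\rangle = m$; weakening along $w_1\le w_2 \le w_3$ equals weakening along $w_1\le w_2$ followed by weakening along $w_2\le w_3$; and $\mathrm{bind}^{\mathcal D}(\mathrm{weaken}\langle w_m\le w_m', m\rangle)(\lambda a.\,\mathrm{weaken}\langle w_f a\le w_f' a, f a\rangle) = \mathrm{weaken}\langle \mathrm{bind}^W w_m w_f \le \mathrm{bind}^W w_m' w_f', \mathrm{bind}^{\mathcal D} m f\rangle$. $\mathrm{DMon}^{\le}$ is the category whose objects are pairs of an ordered monad $W$ and a Dijkstra monad over $W$ with weakening structure. A morphism from $(W_1,\mathcal D_1)$ to $(W_2,\mathcal D_2)$ is a monotonic monad morphism $\Theta^W : W_1 \to W_2$ together with maps $\Theta^{\mathcal D}_{A,w} : \mathcal D_1\,A\,w \to \mathcal D_2\,A\,(\Theta^W w)$ that preserve return, bind and weakening. A monadic relation $\mathcal R : M \leftrightarrow W$ is a family of relations $\mathcal R_A : M A \times W A \to \mathbb P$ such that $(\mathrm{ret}^M v)\,\mathcal R_A\,(\mathrm{ret}^W v)$ for all $v:A$, and such that $m_1\,\mathcal R_A\,w_1$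 and $(m_2\,x)\,\mathcal R_B\,(w_2\,x)$ for all $x:A$ imply $(\mathrm{bind}^M m_1\,m_2)\,\mathcal R_B\,(\mathrm{bind}^W w_1\,w_2)$. It is upward closed if $M$ has the discrete order, $W$ is ordered, and $m\,\mathcal R_A\,w_1$ with $w_1\le_A w_2$ implies $m\,\mathcal R_A\,w_2$. $\mathrm{MonRel}^{\le}$ is the category whose objects are pairs of monads $M$, $W$ with an upward closed monadic relation $\mathcal R : M \leftrightarrow W$. A morphism from $\mathcal R^1 : M_1\leftrightarrow W_1$ to $\mathcal R^2 : M_2\leftrightarrow W_2$ is a pair of monad morphisms $\Theta^M : M_1\to M_2$ and $\Theta^W : W_1\to W_2$ (monotonic) such that $m\,\mathcal R^1_A\,w$ implies $\Theta^M(m)\,\mathcal R^2_A\,\Theta^W(w)$. An effect observation $\theta$ gives the upward closed monadic relation $\theta_A(m)\le_A w$, and $\mathfrak{pre}$ of this relation is the $\mathfrak{pre}\,\theta$ of the claim; it is as such an object that $\theta$ is compared with $\int(\mathfrak{pre}\,\theta)$, ''equivalent'' meaning isomorphic.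
   Formalization: The relation ∼ is taken as the least family of equivalence relations that contains the generating pairs and is respected by bind; the plain equivalence relation generated at each type A need not be respected by bind, so the quotient would not inherit a monad structure. *)

(* Defs.v *)
From Stdlib Require Import FunctionalExtensionality ProofIrrelevance.
From Stdlib Require Import IndefiniteDescription.
Import EqNotations.

Set Implicit Arguments.
Unset Strict Implicit.

Record Category := {
  Obj :> Type;
  Hom : Obj -> Obj -> Type;
  idm : forall X, Hom X X;
  comp : forall {X Y Z}, Hom Y Z -> Hom X Y -> Hom X Z;
  comp_id_l : forall X Y (f : Hom X Y), comp (idm Y) f = f;
  comp_id_r : forall X Y (f : Hom X Y), comp f (idm X) = f;
  comp_assoc : forall X Y Z T (f : Hom Z T) (g : Hom Y Z) (h : Hom X Y),
    comp f (comp g h) = comp (comp f g) h }.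

Arguments Hom {_} _ _.
Arguments idm {_} _.
Arguments comp {_ _ _ _} _ _.

(** The object map is a parameter, so that a functor can be asserted to exist
    with a prescribed action on objects without equating structured types. *)
Record Functor (C D : Category) (F : C -> D) := {
  fmap : forall {X Y : C}, Hom X Y -> Hom (F X) (F Y);
  fmap_id : forall X : C, fmap (idm X) = idm (F X);
  fmap_comp : forall (X Y Z : C) (f : Hom Y Z) (g : Hom X Y),
    fmap (comp f g) = comp (fmap f) (fmap g) }.

Arguments Functor : clear implicits.
Arguments fmap {C D F} _ {X Y} _.

(** [Adjunction L R]: [L] is left adjoint to [R]. *)
Record Adjunction (C D : Category) (F : C -> D) (G : D -> C)
    (L : Functor C D F) (R : Functor D C G) := {
  adj_to : forall {X : C} {Y : D}, Hom (F X) Y -> Hom X (G Y);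
  adj_from : forall {X : C} {Y : D}, Hom X (G Y) -> Hom (F X) Y;
  adj_to_from : forall X Y (g : Hom X (G Y)), adj_to (adj_from g) = g;
  adj_from_to : forall X Y (f : Hom (F X) Y), adj_from (adj_to f) = f;
  adj_natural : forall (X X' : C) (Y Y' : D)
      (a : Hom X' X) (b : Hom Y Y') (f : Hom (F X) Y),
    adj_to (comp b (comp f (fmap L a))) = comp (fmap R b) (comp (adj_to f) a) }.

Arguments Adjunction {C D F G} L R.

Definition Isomorphic (C : Category) (X Y : C) : Prop :=
  exists (f : Hom X Y) (g : Hom Y X), comp g f = idm X /\ comp f g = idm Y.

Arguments Isomorphic {C} X Y.

Record MonadOps := {
  mT :> Type -> Type;
  ret : forall A, A -> mT A;
  bind : forall A B, mT A -> (A -> mT B) -> mT B }.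

Arguments ret _ {A} _.
Arguments bind _ {A B} _ _.

Record IsMonad (M : MonadOps) : Prop := {
  bind_ret_r : forall A (m : M A), bind M m (fun x => ret M x) = m;
  bind_ret_l : forall A B (x : A) (f : A -> M B), bind M (ret M x) f = f x;
  bind_bind : forall A B C (m : M A) (f : A -> M B) (g : B -> M C),
    bind M (bind M m f) g = bind M m (fun x => bind M (f x) g) }.

Record Monad := {
  monad_ops :> MonadOps;
  monad_laws : IsMonad monad_ops }.

Definition mmap (M : MonadOps) A B (f : A -> B) (m : M A) : M B :=
  bind M m (fun x => ret M (f x)).

Arguments mmap M {A B} f m.

Record OrderedMonad := {
  om_monad :> Monad;
  le : forall {A}, om_monad A -> om_monad A -> Prop;
  le_refl : forall A (w : om_monad A), le w w;
  le_trans : forall A (w1 w2 w3 : om_monad A), le w1 w2 -> le w2 w3 -> le w1 w3;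
  bind_mono : forall A B (w1 w1' : om_monad A) (w2 w2' : A -> om_monad B),
    le w1 w1' -> (forall x, le (w2 x) (w2' x)) ->
    le (bind om_monad w1 w2) (bind om_monad w1' w2') }.

Arguments le _ {A} _ _.

Record MonadMorphism (M W : Monad) := {
  mm_fun :> forall {A}, M A -> W A;
  mm_natural : forall A B (f : A -> B) (m : M A),
    mm_fun (mmap M f m) = mmap W f (mm_fun m);
  mm_ret : forall A (x : A), mm_fun (ret M x) = ret W x;
  mm_bind : forall A B (m : M A) (f : A -> M B),
    mm_fun (bind M m f) = bind W (mm_fun m) (fun x => mm_fun (f x)) }.

Arguments mm_fun {M W} _ A _.

Record MonotoneMorphism (W1 W2 : OrderedMonad) := {
  om_mor :> MonadMorphism W1 W2;
  om_mono : forall A (w w' : W1 A), le W1 w w' -> le W2 (om_mor A w) (om_mor A w') }.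

Record DijkstraOps (W : MonadOps) := {
  dT :> forall {A}, W A -> Type;
  dret : forall {A} (x : A), dT (ret W x);
  dbind : forall A B (w1 : W A) (w2 : A -> W B),
    dT w1 -> (forall x, dT (w2 x)) -> dT (bind W w1 w2) }.

Arguments dT {W} _ A _.
Arguments dret {W} _ {A} _.
Arguments dbind {W} _ {A B w1 w2} _ _.

(** The equations typed thanks to the monad laws of [W] become equations up to
    transport along these laws. *)
Record IsDijkstraMonad (W : Monad) (D : DijkstraOps W) : Prop := {
  dbind_ret_r : forall A (w : W A) (m : D A w),
    rew [D A] bind_ret_r (monad_laws W) w in dbind D m (fun x => dret D x) = m;
  dbind_ret_l : forall A B (x : A) (w : A -> W B) (f : forall x, D B (w x)),
    rew [D B] bind_ret_l (monad_laws W) x w in dbind D (dret D x) f = f x;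
  dbind_bind : forall A B C (w : W A) (wf : A -> W B) (wg : B -> W C)
      (m : D A w) (f : forall x, D B (wf x)) (g : forall y, D C (wg y)),
    rew [D C] bind_bind (monad_laws W) w wf wg in dbind D (dbind D m f) g
    = dbind D m (fun x => dbind D (f x) g) }.

Definition WeakenOp (W : OrderedMonad) (D : DijkstraOps W) :=
  forall A (w1 w2 : W A), le W w1 w2 -> D A w1 -> D A w2.

Arguments WeakenOp W D : clear implicits.

Record IsWeakening (W : OrderedMonad) (D : DijkstraOps W) (wk : WeakenOp W D)
    : Prop := {
  weaken_refl : forall A (w : W A) (h : le W w w) (m : D A w), wk A w w h m = m;
  weaken_trans : forall A (w1 w2 w3 : W A) (h12 : le W w1 w2) (h23 : le W w2 w3)
      (h13 : le W w1 w3) (m : D A w1),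
    wk A w1 w3 h13 m = wk A w2 w3 h23 (wk A w1 w2 h12 m);
  weaken_bind : forall A B (wm wm' : W A) (wf wf' : A -> W B)
      (hm : le W wm wm') (hf : forall a, le W (wf a) (wf' a))
      (h : le W (bind W wm wf) (bind W wm' wf'))
      (m : D A wm) (f : forall a, D B (wf a)),
    dbind D (wk A wm wm' hm m) (fun a => wk B (wf a) (wf' a) (hf a) (f a))
    = wk B (bind W wm wf) (bind W wm' wf') h (dbind D m f) }.

Arguments IsDijkstraMonad W D : clear implicits.
Arguments IsWeakening {W D} wk.

Record DMonObj := {
  dm_W : OrderedMonad;
  dm_D :> DijkstraOps dm_W;
  dm_laws : IsDijkstraMonad dm_W dm_D;
  dm_weaken : WeakenOp dm_W dm_D;
  dm_weaken_laws : IsWeakening dm_weaken }.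

Arguments dm_weaken _ {A w1 w2} _ _.

Record DMonHom (X Y : DMonObj) := {
  dh_W : MonotoneMorphism (dm_W X) (dm_W Y);
  dh_D : forall {A} {w : dm_W X A}, X A w -> Y A (dh_W A w);
  dh_ret : forall A (x : A),
    rew [Y A] mm_ret dh_W x in dh_D (dret X x) = dret Y x;
  dh_bind : forall A B (w1 : dm_W X A) (w2 : A -> dm_W X B)
      (m : X A w1) (f : forall x, X B (w2 x)),
    rew [Y B] mm_bind dh_W w1 w2 in dh_D (dbind X m f)
    = dbind Y (dh_D m) (fun x => dh_D (f x));
  dh_weaken : forall A (w1 w2 : dm_W X A) (h : le (dm_W X) w1 w2) (m : X A w1),
    dh_D (dm_weaken X h m) = dm_weaken Y (om_mono dh_W h) (dh_D m) }.

Arguments dh_D {X Y} _ {A w} _.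

Record IsMonadicRelation (M W : MonadOps) (R : forall A, M A -> W A -> Prop)
    : Prop := {
  rel_ret : forall A (x : A), R A (ret M x) (ret W x);
  rel_bind : forall A B (m1 : M A) (w1 : W A) (m2 : A -> M B) (w2 : A -> W B),
    R A m1 w1 -> (forall x, R B (m2 x) (w2 x)) ->
    R B (bind M m1 m2) (bind W w1 w2) }.

Definition UpwardClosed (M : MonadOps) (W : OrderedMonad)
    (R : forall A, M A -> W A -> Prop) : Prop :=
  forall A (m : M A) (w1 w2 : W A), R A m w1 -> le W w1 w2 -> R A m w2.

Arguments IsMonadicRelation M W R : clear implicits.
Arguments UpwardClosed M W R : clear implicits.

Record MonRelObj := {
  mr_M : Monad;
  mr_W : OrderedMonad;
  mr_rel :> forall A, mr_M A -> mr_W A -> Prop;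
  mr_laws : IsMonadicRelation mr_M mr_W mr_rel;
  mr_up : UpwardClosed mr_M mr_W mr_rel }.

(** Monotonicity of [mh_M] is void, the domain and codomain being discretely
    ordered. *)
Record MonRelHom (X Y : MonRelObj) := {
  mh_M : MonadMorphism (mr_M X) (mr_M Y);
  mh_W : MonotoneMorphism (mr_W X) (mr_W Y);
  mh_rel : forall A (m : mr_M X A) (w : mr_W X A),
    X A m w -> Y A (mh_M A m) (mh_W A w) }.

Definition mm_id (M : Monad) : MonadMorphism M M.
Proof. now exists (fun A m => m). Defined.

Definition mm_comp (M N P : Monad) (g : MonadMorphism N P) (f : MonadMorphism M N)
  : MonadMorphism M P.
Proof.
  exists (fun A m => g A (f A m)); intros.
  - now rewrite !mm_natural.
  - now rewrite !mm_ret.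
  - now rewrite !mm_bind.
Defined.

Definition om_id (W : OrderedMonad) : MonotoneMorphism W W.
Proof. now exists (mm_id W). Defined.

Definition om_comp (U V W : OrderedMonad)
  (g : MonotoneMorphism V W) (f : MonotoneMorphism U V) : MonotoneMorphism U W.
Proof.
  exists (mm_comp g f). intros A w w' h; simpl. now do 2 apply om_mono.
Defined.

Definition dh_id (X : DMonObj) : DMonHom X X.
Proof.
  exists (om_id (dm_W X)) (fun A w c => c); reflexivity.
Defined.

Definition dh_comp (X Y Z : DMonObj) (g : DMonHom Y Z) (f : DMonHom X Y)
  : DMonHom X Z.
Proof.
  exists (om_comp (dh_W g) (dh_W f)) (fun A w c => dh_D g (dh_D f c)); intros; simpl.
  - rewrite <- (dh_ret g), <- (dh_ret f).
    generalize (mm_ret (dh_W g) x), (mm_ret (om_comp (dh_W g) (dh_W f)) x).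
    destruct (mm_ret (dh_W f) x); intros e1 e2.
    f_equal; apply proof_irrelevance.
  - rewrite <- (dh_bind g), <- (dh_bind f).
    generalize (mm_bind (dh_W g) (dh_W f A w1) (fun x => dh_W f B (w2 x))),
      (mm_bind (om_comp (dh_W g) (dh_W f)) w1 w2).
    destruct (mm_bind (dh_W f) w1 w2); intros e1 e2.
    f_equal; apply proof_irrelevance.
  - rewrite !dh_weaken. f_equal; apply proof_irrelevance.
Defined.

Definition mh_id (X : MonRelObj) : MonRelHom X X.
Proof. now exists (mm_id (mr_M X)) (om_id (mr_W X)). Defined.

Definition mh_comp (X Y Z : MonRelObj) (g : MonRelHom Y Z) (f : MonRelHom X Y)
  : MonRelHom X Z.
Proof.
  exists (mm_comp (mh_M g) (mh_M f)) (om_comp (mh_W g) (mh_W f)).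
  intros A m w h; simpl. now do 2 apply mh_rel.
Defined.

Lemma mm_eq (M W : Monad) (f g : MonadMorphism M W) :
  mm_fun f = mm_fun g -> f = g.
Proof.
  destruct f, g; simpl; intros <-; f_equal; apply proof_irrelevance.
Qed.

Lemma om_eq (U W : OrderedMonad) (f g : MonotoneMorphism U W) :
  mm_fun f = mm_fun g -> f = g.
Proof.
  destruct f as [f hf], g as [g hg]; simpl; intros e.
  apply mm_eq in e; subst; f_equal; apply proof_irrelevance.
Qed.

(** Equality of Dijkstra monad morphisms, stated on their graphs to avoid
    transports between the two families [dh_D]. *)
Lemma dh_eq (X Y : DMonObj) (f g : DMonHom X Y) :
  mm_fun (dh_W f) = mm_fun (dh_W g) ->
  (forall A (w : dm_W X A) (c : X A w),
    existT (Y A) (dh_W f A w) (dh_D f c) = existT (Y A) (dh_W g A w) (dh_D g c)) ->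
  f = g.
Proof.
  destruct f as [fW fD f1 f2 f3], g as [gW gD g1 g2 g3]; simpl; intros e.
  apply om_eq in e; subst gW; intros H.
  assert (fD = gD) as <-.
  { do 3 (apply functional_extensionality_dep; intro).
    apply inj_pair2, H. }
  f_equal; apply proof_irrelevance.
Qed.

Lemma mh_eq (X Y : MonRelObj) (f g : MonRelHom X Y) :
  mm_fun (mh_M f) = mm_fun (mh_M g) -> mm_fun (mh_W f) = mm_fun (mh_W g) -> f = g.
Proof.
  destruct f, g; simpl; intros e1 e2.
  apply mm_eq in e1; apply om_eq in e2; subst; f_equal; apply proof_irrelevance.
Qed.

Definition DMon : Category.
Proof.
  refine {| Obj := DMonObj; Hom := DMonHom; idm := dh_id; comp := dh_comp |};
    intros; now apply dh_eq.
Defined.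

Definition MonRel : Category.
Proof.
  refine {| Obj := MonRelObj; Hom := MonRelHom; idm := mh_id; comp := mh_comp |};
    intros; now apply mh_eq.
Defined.

Definition obs_rel (M : Monad) (W : OrderedMonad) (theta : MonadMorphism M W)
  : MonRelObj.
Proof.
  refine {| mr_M := M; mr_W := W; mr_rel := fun A m w => le W (theta A m) w |}.
  - split; intros.
    + rewrite mm_ret. apply le_refl.
    + rewrite mm_bind. now apply bind_mono.
  - intros A m w1 w2 h h'. exact (le_trans h h').
Defined.

Definition pre_ops (R : MonRelObj) : DijkstraOps (mr_W R) := {|
  dT := fun A w => {m : mr_M R A | R A m w};
  dret := fun A x => exist _ (ret (mr_M R) x) (rel_ret (mr_laws R) x);
  dbind := fun A B w1 w2 m f =>
    exist _ (bind (mr_M R) (proj1_sig m) (fun x => proj1_sig (f x)))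
      (rel_bind (mr_laws R) (proj2_sig m) (fun x => proj2_sig (f x))) |}.

Definition pre_weaken (R : MonRelObj) : WeakenOp (mr_W R) (pre_ops R) :=
  fun A w1 w2 h m =>
    exist _ (proj1_sig m) (mr_up (proj2_sig m) h).

Arguments pre_weaken R : clear implicits.

Definition pre (R : MonRelObj) (HD : IsDijkstraMonad (mr_W R) (pre_ops R))
    (Hwk : IsWeakening (pre_weaken R)) : DMonObj := {|
  dm_W := mr_W R;
  dm_D := pre_ops R;
  dm_laws := HD;
  dm_weaken := pre_weaken R;
  dm_weaken_laws := Hwk |}.

Arguments pre R HD Hwk : clear implicits.

Definition quot (X : Type) (E : X -> X -> Prop) : Type :=
  {P : X -> Prop | exists x, P = E x}.

Definition cls (X : Type) (E : X -> X -> Prop) (x : X) : quot E :=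
  exist _ (E x) (ex_intro _ x eq_refl).

Definition repr (X : Type) (E : X -> X -> Prop) (q : quot E) : X :=
  proj1_sig (constructive_indefinite_description _ (proj2_sig q)).

(** The pairs [(w : W A) * D A w], with the monad operations acting on both
    components. *)
Definition tot_ops (X : DMonObj) : MonadOps := {|
  mT := fun A => {w : dm_W X A & X A w};
  ret := fun A x => existT _ (ret (dm_W X) x) (dret X x);
  bind := fun A B p f =>
    existT _ (bind (dm_W X) (projT1 p) (fun x => projT1 (f x)))
             (dbind X (projT2 p) (fun x => projT2 (f x))) |}.

(** The least family of equivalence relations that contains the pairs
    [<w, c> ~ <w', weaken <w <= w', c>>] and is respected by bind.  The last
    clause is needed for bind to descend to the quotient: the plain equivalence
    closure of the generating pairs at each type [A] relates elements joined by
    a finite zigzag, and a family of zigzags indexed by an infinite type [A] may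
    have unbounded lengths. *)
Inductive weq (X : DMonObj) : forall A, tot_ops X A -> tot_ops X A -> Prop :=
| weq_weaken : forall A (w w' : dm_W X A) (h : le (dm_W X) w w') (c : X A w),
    @weq X A (existT _ w c) (existT _ w' (dm_weaken X h c))
| weq_refl : forall A (p : tot_ops X A), @weq X A p p
| weq_sym : forall A (p q : tot_ops X A), @weq X A p q -> @weq X A q p
| weq_trans : forall A (p q r : tot_ops X A),
    @weq X A p q -> @weq X A q r -> @weq X A p r
| weq_bind : forall A B (p q : tot_ops X A) (f g : A -> tot_ops X B),
    @weq X A p q -> (forall x, @weq X B (f x) (g x)) ->
    @weq X B (bind (tot_ops X) p f) (bind (tot_ops X) q g).

Definition int_cls (X : DMonObj) A (p : tot_ops X A) : quot (@weq X A) :=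
  cls (@weq X A) p.

Arguments int_cls X {A} p.

Definition int_ops (X : DMonObj) : MonadOps := {|
  mT := fun A => quot (@weq X A);
  ret := fun A x => int_cls X (ret (tot_ops X) x);
  bind := fun A B q f =>
    int_cls X (bind (tot_ops X) (repr q) (fun x => repr (f x))) |}.

(** The monadic relation between [int_ops X] and [W]: a class is related to the
    specifications of its representatives. *)
Definition int_rel (X : DMonObj) A (q : int_ops X A) (w : dm_W X A) : Prop :=
  exists c : X A w, q = int_cls X (existT _ w c).

Definition int_monad (X : DMonObj) (HM : IsMonad (int_ops X)) : Monad :=
  {| monad_ops := int_ops X; monad_laws := HM |}.

Arguments int_monad X HM : clear implicits.

Definition int (X : DMonObj) (HM : IsMonad (int_ops X))
    (HR : IsMonadicRelation (int_ops X) (dm_W X) (@int_rel X))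
    (HU : UpwardClosed (int_ops X) (dm_W X) (@int_rel X)) : MonRelObj := {|
  mr_M := int_monad X HM;
  mr_W := dm_W X;
  mr_rel := @int_rel X;
  mr_laws := HR;
  mr_up := HU |}.

Arguments int X HM HR HU : clear implicits.

(* Main.v *)
From Stdlib Require Import FunctionalExtensionality PropExtensionality ProofIrrelevance.
From Stdlib Require Import IndefiniteDescription.
Require Import Defs.
Import EqNotations.

(** Everything reduces to the total monad [tot_ops X] of pairs [<w, c>].  The
    congruence [weq] makes its monad structure descend to classes, and a map on
    pairs that preserves return and bind and forgets weakenings respects [weq]
    by induction.  Hence morphisms [int X -> R] and morphisms [X -> pre R] are
    the same data, since [pre_weaken] does not change the computation.  For an
    effect observation, [<w, m>] is the weakening of [<theta m, m>], so a class
    amounts to a computation [m]. *)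

(** * Quotients as sets of equivalence classes *)

Section Quotient.

Variables (X : Type) (E : X -> X -> Prop).
Hypothesis E_refl : forall x, E x x.
Hypothesis E_sym : forall x y, E x y -> E y x.
Hypothesis E_trans : forall x y z, E x y -> E y z -> E x z.

(** Symmetry and transitivity make the predicates [E x] and [E y] pointwise equivalent, and
    extensionality identifies them. *)
Lemma cls_eq x y : E x y -> cls E x = cls E y.
Proof.
  intros h. apply subset_eq_compat, functional_extensionality; intros z.
  apply propositional_extensionality; split; eauto.
Qed.

Lemma cls_repr (q : quot E) : cls E (repr q) = q.
Proof.
  destruct q as [P hP]; unfold repr.
  destruct constructive_indefinite_description as [x hx]; simpl in *.
  now apply subset_eq_compat.
Qed.

Lemma repr_cls x : E (repr (cls E x)) x.
Proof.
  (* Equality of the two classes is equality of predicates, to be evaluated at [x]. *)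
  assert (e := f_equal (@proj1_sig _ _) (cls_repr (cls E x))); simpl in e.
  rewrite e. apply E_refl.
Qed.

End Quotient.

(** * The Dijkstra monad of an upward closed relation *)

Section Pre.

Variable R : MonRelObj.

Lemma pre_ext A (w : mr_W R A) (x y : pre_ops R A w) :
  proj1_sig x = proj1_sig y -> x = y.
Proof. destruct x, y; apply subset_eq_compat. Qed.

(** Only the proof component depends on the specification, so the transports in the Dijkstra monad
    laws leave the computation alone and the laws reduce to those of the computational monad. *)
Lemma proj1_sig_rew A (w w' : mr_W R A) (e : w = w') (x : pre_ops R A w) :
  proj1_sig (rew [pre_ops R A] e in x) = proj1_sig x.
Proof. now destruct e. Qed.

Lemma existT_pre_ext A (w w' : mr_W R A) (x : pre_ops R A w) (y : pre_ops R A w') :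
  w = w' -> proj1_sig x = proj1_sig y ->
  existT (pre_ops R A) w x = existT (pre_ops R A) w' y.
Proof. intros <- e. now rewrite (pre_ext _ _ _ _ e). Qed.

Lemma pre_dijkstra : IsDijkstraMonad (mr_W R) (pre_ops R).
Proof.
  split; intros; apply pre_ext; rewrite proj1_sig_rew; simpl;
    apply (monad_laws (mr_M R)).
Qed.

Lemma pre_weakening : IsWeakening (pre_weaken R).
Proof. split; intros; now apply pre_ext. Qed.

End Pre.

Definition pre_obj (R : MonRelObj) : DMonObj :=
  pre R (pre_dijkstra R) (pre_weakening R).

Definition pre_map (R S : MonRelObj) (t : MonRelHom R S) :
  DMonHom (pre_obj R) (pre_obj S).
Proof.
  refine (@Build_DMonHom (pre_obj R) (pre_obj S) (mh_W t)
    (fun A w (x : pre_obj R A w) =>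
       exist _ (mh_M t A (proj1_sig x)) (mh_rel t (proj2_sig x))) _ _ _);
    intros; apply pre_ext; rewrite ?(proj1_sig_rew S); simpl.
  - apply mm_ret.
  - apply mm_bind.
  - reflexivity.
Defined.

Definition pre_functor : Functor MonRel DMon pre_obj.
Proof.
  refine (@Build_Functor MonRel DMon pre_obj pre_map _ _);
    intros; apply dh_eq; try reflexivity;
    intros; now apply existT_pre_ext.
Defined.

(** * The monad of classes of pairs and its relation *)

Section Int.

Variable X : DMonObj.

Lemma existT_rew A (w w' : dm_W X A) (e : w = w') (c : X A w) (c' : X A w') :
  rew [X A] e in c = c' -> existT (X A) w c = existT (X A) w' c'.
Proof. now destruct e; intros <-. Qed.

Lemma tot_monad : IsMonad (tot_ops X).
Proof.
  split; simpl.
  - intros A [w c]; eapply existT_rew, (dbind_ret_r (dm_laws X)).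
  (* [f x] has to be expanded into a pair before [existT_rew] applies. *)
  - intros A B x f. etransitivity; [| symmetry; apply sigT_eta].
    eapply existT_rew, (dbind_ret_l (dm_laws X) x (fun x => projT2 (f x))).
  - intros A B C [w c] f g; eapply existT_rew, (dbind_bind (dm_laws X)).
Qed.

Lemma int_cls_eq A (p q : tot_ops X A) : @weq X A p q -> int_cls X p = int_cls X q.
Proof. apply cls_eq; [apply weq_sym | apply weq_trans]. Qed.

Lemma repr_int_cls A (p : tot_ops X A) : @weq X A (repr (int_cls X p)) p.
Proof. apply repr_cls, weq_refl. Qed.

Lemma int_cls_surj A (q : int_ops X A) : exists p, q = int_cls X p.
Proof. exists (repr q). symmetry; apply cls_repr. Qed.

(** Representatives are chosen for a whole family at once, so that the monad laws for classes reduce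
    to those for pairs. *)
Lemma int_cls_surj_fam A B (f : A -> int_ops X B) :
  exists g, f = fun x => int_cls X (g x).
Proof.
  exists (fun x => repr (f x)). apply functional_extensionality; intros x.
  symmetry; apply cls_repr.
Qed.

(** The representatives chosen by [repr] do not matter, because [weq] is closed under bind, also
    along infinite families. *)
Lemma bind_int_cls A B (p : tot_ops X A) (f : A -> tot_ops X B) :
  bind (int_ops X) (int_cls X p) (fun x => int_cls X (f x))
  = int_cls X (bind (tot_ops X) p f).
Proof. apply int_cls_eq, weq_bind; intros; apply repr_int_cls. Qed.

Lemma int_is_monad : IsMonad (int_ops X).
Proof.
  split.
  - intros A q. destruct (int_cls_surj _ q) as [p ->].
    etransitivity; [apply bind_int_cls |].
    now rewrite (bind_ret_r tot_monad).
  - intros A B x f. destruct (int_cls_surj_fam _ _ f) as [g ->].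
    etransitivity; [apply bind_int_cls |].
    now rewrite (bind_ret_l tot_monad).
  - intros A B C q f g. destruct (int_cls_surj _ q) as [p ->].
    destruct (int_cls_surj_fam _ _ f) as [f' ->], (int_cls_surj_fam _ _ g) as [g' ->].
    rewrite !bind_int_cls, (bind_bind tot_monad).
    rewrite <- bind_int_cls. f_equal.
    apply functional_extensionality; intros x. now rewrite bind_int_cls.
Qed.

Lemma int_is_relation : IsMonadicRelation (int_ops X) (dm_W X) (@int_rel X).
Proof.
  split.
  - intros A x. now exists (dret X x).
  - intros A B q w f wf [c ->] h.
    (* Each [h x] only asserts existence; choice assembles the witnesses into a function that
       [dbind] accepts. *)
    set (g x := proj1_sig (constructive_indefinite_description _ (h x))).
    assert (e : f = fun x => int_cls X (existT (X B) (wf x) (g x))).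
    { apply functional_extensionality; intros x. unfold g.
      now destruct constructive_indefinite_description. }
    exists (dbind X c g). rewrite e. apply bind_int_cls.
Qed.

Lemma int_upward_closed : UpwardClosed (int_ops X) (dm_W X) (@int_rel X).
Proof.
  intros A q w w' [c ->] h. exists (dm_weaken X h c).
  apply int_cls_eq, weq_weaken.
Qed.

End Int.

Definition int_obj (X : DMonObj) : MonRelObj :=
  int X (int_is_monad X) (int_is_relation X) (int_upward_closed X).

(** * Transposition between the two kinds of morphisms *)

Definition ret_bind_morphism (M W : Monad) (t : forall A, M A -> W A)
  (t_ret : forall A (x : A), t A (ret M x) = ret W x)
  (t_bind : forall A B (m : M A) (f : A -> M B),
     t B (bind M m f) = bind W (t A m) (fun x => t B (f x))) :
  MonadMorphism M W.
Proof.
  refine {| mm_fun := t; mm_ret := t_ret; mm_bind := t_bind |}.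
  intros A B f m. unfold mmap. rewrite t_bind. f_equal.
  apply functional_extensionality; intros x; apply t_ret.
Defined.

Lemma int_hom_eq (X : DMonObj) (R : MonRelObj) (s t : MonRelHom (int_obj X) R) :
  (forall A p, mh_M s A (int_cls X p) = mh_M t A (int_cls X p)) ->
  mm_fun (mh_W s) = mm_fun (mh_W t) -> s = t.
Proof.
  intros h. apply mh_eq.
  apply functional_extensionality_dep; intros A.
  apply functional_extensionality; intros q.
  destruct (int_cls_surj X _ q) as [p ->]; apply h.
Qed.

Section Transpose.

Variables (X : DMonObj) (R : MonRelObj).

(** An element [c] goes to the image of its class. Weakening is preserved because [c] and its
    weakenings share one class. *)
Definition to_pre (t : MonRelHom (int_obj X) R) : DMonHom X (pre_obj R).
Proof.
  refine (@Build_DMonHom X (pre_obj R) (mh_W t)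
    (fun A w (c : X A w) =>
       exist (fun m => R A m (mh_W t A w))
         (mh_M t A (int_cls X (existT _ w c)))
         (mh_rel t (ex_intro _ c eq_refl : int_obj X A _ w))) _ _ _);
    intros; apply pre_ext; rewrite ?(proj1_sig_rew R); simpl.
  - apply (mm_ret (mh_M t)).
  - etransitivity; [| apply (mm_bind (mh_M t))].
    f_equal; symmetry; apply (bind_int_cls X A B (existT _ w1 m) (fun x => existT _ (w2 x) (f x))).
  - f_equal. symmetry; apply int_cls_eq, weq_weaken.
Defined.

Variable t : DMonHom X (pre_obj R).

Definition tot_map A (p : tot_ops X A) : mr_M R A :=
  proj1_sig (dh_D t (projT2 p)).

Lemma tot_map_bind A B (p : tot_ops X A) (f : A -> tot_ops X B) :
  tot_map B (bind (tot_ops X) p f)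
  = bind (mr_M R) (tot_map A p) (fun x => tot_map B (f x)).
Proof.
  assert (e := f_equal (@proj1_sig _ _)
    (dh_bind t (projT2 p) (fun x => projT2 (f x)))).
  now rewrite (proj1_sig_rew R) in e.
Qed.

Lemma tot_map_ret A (x : A) : tot_map A (ret (tot_ops X) x) = ret (mr_M R) x.
Proof.
  assert (e := f_equal (@proj1_sig _ _) (dh_ret t x)).
  now rewrite (proj1_sig_rew R) in e.
Qed.

(** Morphisms into [pre_obj R] commute with weakening, which keeps the computation there; this
    settles the generating pairs. The bind clause is [tot_map_bind]. *)
Lemma tot_map_weq A (p q : tot_ops X A) : @weq X A p q -> tot_map A p = tot_map A q.
Proof.
  induction 1; try congruence.
  - unfold tot_map; simpl. now rewrite dh_weaken.
  - rewrite !tot_map_bind. f_equal; [assumption |].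
    now apply functional_extensionality.
Qed.

Definition int_lift A (q : int_ops X A) : mr_M R A := tot_map A (repr q).

Lemma int_lift_cls A (p : tot_ops X A) : int_lift A (int_cls X p) = tot_map A p.
Proof. apply tot_map_weq, repr_int_cls. Qed.

Definition from_pre : MonRelHom (int_obj X) R.
Proof.
  assert (hr : forall A (x : A), int_lift A (ret (int_ops X) x) = ret (mr_M R) x).
  { intros A x. etransitivity; [apply int_lift_cls | apply tot_map_ret]. }
  assert (hb : forall A B (q : int_ops X A) (f : A -> int_ops X B),
    int_lift B (bind (int_ops X) q f)
    = bind (mr_M R) (int_lift A q) (fun x => int_lift B (f x))).
  { intros A B q f. etransitivity; [apply int_lift_cls | apply tot_map_bind]. }
  refine (@Build_MonRelHom (int_obj X) R
    (ret_bind_morphism (mr_M (int_obj X)) _ int_lift hr hb) (dh_W t) _).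
  intros A q w [c ->]; simpl.
  (* The relation is the proof already carried by the element [dh_D t c]. *)
  rewrite int_lift_cls. exact (proj2_sig (dh_D t c)).
Defined.

Lemma from_pre_cls A (p : tot_ops X A) :
  mh_M from_pre A (int_cls X p) = proj1_sig (dh_D t (projT2 p)).
Proof. apply int_lift_cls. Qed.

End Transpose.

(** * Functoriality of the quotient and the adjunction *)

(** The transpose of [t] followed by the unit of the adjunction, the unit being [to_pre] of the
    identity. *)
Definition int_map (X Y : DMonObj) (t : DMonHom X Y) :
  MonRelHom (int_obj X) (int_obj Y) :=
  from_pre X (int_obj Y) (dh_comp (to_pre Y (int_obj Y) (mh_id _)) t).

Lemma int_map_cls (X Y : DMonObj) (t : DMonHom X Y) A (p : tot_ops X A) :
  mh_M (int_map X Y t) A (int_cls X p)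
  = int_cls Y (existT _ (dh_W t A (projT1 p)) (dh_D t (projT2 p))).
Proof. apply int_lift_cls. Qed.

Definition int_functor : Functor DMon MonRel int_obj.
Proof.
  refine (@Build_Functor DMon MonRel int_obj int_map _ _).
  - intros X. apply int_hom_eq; [| reflexivity].
    intros A [w c]. apply int_map_cls.
  - intros X Y Z g f. apply int_hom_eq; [| reflexivity].
    intros A p. etransitivity; [apply int_map_cls |]. symmetry.
    etransitivity; [apply (f_equal (mh_M (int_map Y Z g) A)), int_map_cls |].
    etransitivity; [apply int_map_cls | reflexivity].
Defined.

Definition int_pre_adjunction : Adjunction int_functor pre_functor.
Proof.
  refine (@Build_Adjunction DMon MonRel int_obj pre_obj int_functor pre_functor
    to_pre from_pre _ _ _).
  - intros X R g. apply dh_eq; [reflexivity |].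
    intros A w c. apply (existT_pre_ext R); [reflexivity |].
    apply (from_pre_cls X R g A (existT _ w c)).
  - intros X R f. apply int_hom_eq; [| reflexivity].
    intros A [w c]. apply from_pre_cls.
  - intros X X' R R' a b f. apply dh_eq; [reflexivity |].
    intros A w c. apply (existT_pre_ext R'); [reflexivity |].
    (* Both sides apply [f] and then [b] to a class, so it remains to compute [int_map] of [a] on
       that class. *)
    apply (f_equal (fun q => mh_M b A (mh_M f A q))).
    apply (int_map_cls X' X a A (existT _ w c)).
Defined.

(** * Recovering an effect observation from its Dijkstra monad *)

Section Observation.

Variables (M : Monad) (W : OrderedMonad) (theta : MonadMorphism M W).

Let D := pre_obj (obs_rel theta).

(** The computation is paired with its least specification. *)
Definition obs_cls A (m : M A) : int_ops D A :=
  int_cls D (existT (D A) (theta A m) (exist _ m (le_refl (theta A m)))).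

Lemma int_cls_obs A (p : tot_ops D A) :
  int_cls D p = obs_cls A (proj1_sig (projT2 p)).
Proof.
  destruct p as [w [m h]]. symmetry.
  (* The weakening is along the inequality [h] carried by the pair itself. *)
  etransitivity; [apply int_cls_eq, (weq_weaken (X := D) h) |].
  apply f_equal. now apply (existT_pre_ext (obs_rel theta)).
Qed.

(** By [int_cls_obs] a class depends only on its computation, so return and bind need only be
    compared on computations. *)
Definition obs_to_int : MonRelHom (obs_rel theta) (int_obj D).
Proof.
  unshelve refine (@Build_MonRelHom (obs_rel theta) (int_obj D)
    (ret_bind_morphism M (mr_M (int_obj D)) obs_cls _ _) (om_id W) _).
  - intros A x. symmetry; apply int_cls_obs.
  - intros A B m f. symmetry.
    etransitivity; [apply (bind_int_cls D) | apply int_cls_obs].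
  - intros A m w h. exists (exist _ m h).
    symmetry; apply (int_cls_obs A (existT (D A) w (exist _ m h))).
Defined.

Lemma int_pre_obs : Isomorphic (C := MonRel) (int_obj D) (obs_rel theta).
Proof.
  (* The forward map is the counit of the adjunction at [obs_rel theta]. *)
  exists (from_pre D (obs_rel theta) (dh_id D)), obs_to_int; split.
  - apply int_hom_eq; [| reflexivity]. intros A p; simpl.
    rewrite int_lift_cls. symmetry; apply int_cls_obs.
  - apply mh_eq; [| reflexivity].
    apply functional_extensionality_dep; intros A.
    apply functional_extensionality; intros m. apply int_lift_cls.
Qed.

End Observation.

Theorem mainTheorem1 :
  (forall (M : Monad) (W : OrderedMonad) (theta : MonadMorphism M W),
     IsDijkstraMonad W (pre_ops (obs_rel theta)) /\
     IsWeakening (pre_weaken (obs_rel theta)))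
  /\
  exists (HD : forall R : MonRelObj, IsDijkstraMonad (mr_W R) (pre_ops R))
         (Hwk : forall R : MonRelObj, IsWeakening (pre_weaken R))
         (preF : Functor MonRel DMon (fun R => pre R (HD R) (Hwk R))),
    (forall (R1 R2 : MonRelObj) (t : MonRelHom R1 R2),
       dh_W (fmap preF t) = mh_W t /\
       forall (A : Type) (w : mr_W R1 A) (x : pre_ops R1 A w),
         proj1_sig (dh_D (fmap preF t) x) = mh_M t A (proj1_sig x))
    /\
    exists (HM : forall X : DMonObj, IsMonad (int_ops X))
           (HR : forall X : DMonObj,
              IsMonadicRelation (int_ops X) (dm_W X) (@int_rel X))
           (HU : forall X : DMonObj,
              UpwardClosed (int_ops X) (dm_W X) (@int_rel X))
           (intF : Functor DMon MonRel (fun X => int X (HM X) (HR X) (HU X))),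
      (forall (X : DMonObj) (A B : Type) (p : tot_ops X A) (f : A -> tot_ops X B),
         bind (int_ops X) (int_cls X p) (fun x => int_cls X (f x))
         = int_cls X (bind (tot_ops X) p f))
      /\
      inhabited (Adjunction intF preF)
      /\
      forall (M : Monad) (W : OrderedMonad) (theta : MonadMorphism M W),
        Isomorphic (C := MonRel)
          (let D := pre (obs_rel theta) (HD (obs_rel theta)) (Hwk (obs_rel theta)) in
           int D (HM D) (HR D) (HU D))
          (obs_rel theta).
Proof.
  split.
  { intros M W theta. split; [apply (pre_dijkstra (obs_rel theta)) | apply (pre_weakening (obs_rel theta))]. }
  exists pre_dijkstra, pre_weakening, pre_functor.
  split; [now split |].
  exists int_is_monad, int_is_relation, int_upward_closed, int_functor.
  split; [exact bind_int_cls |].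
  split; [exact (inhabits int_pre_adjunction) | exact int_pre_obs].
Qed.
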